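(* For all integers $n\geq2$, the complete graph $K_n$ on $n$ vertices satisfies $$\chi^1(K_n)\,=\,n+1.$$
   Context: $\mathbb{Z}^+=\{1,2,\dots\}$. Let $G=(V,E)$ be a graph. An edge coloring is a map $c'\colon E\to\{1,\dots,m\}$ with $c'(e)\neq c'(f)$ for any two distinct edges $e,f$ sharing an end. For a multi-labeling $c\colon V\to\mathcal{P}(\mathbb{Z}^+)$ (with values in the power set of $\mathbb{Z}^+$), an edge coloring $c'$ avoids $c$ if $c'(e)\notin\bigcup_{v\in e}c(v)$ for every $e\in E$. The $c$-avoiding chromatic index $\chi'_c(G)$ is the smallest $m\in\mathbb{Z}^+$ for which there is an edge coloring $c'\colon E\to\{1,\dots,m\}$ that avoids $c$. For $t\in\{0,1,2,\dots\}$, a $t$-labeling is a multi-labeling $c$ with $|c(v)|\le t$ for all $v\in V$, and the $t$-avoiding chromatic index is $\chi^t(G):=\max\{\chi'_c(G) : c \text{ is a } t\text{-labeling}\}$; here $t=1$. *)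

(* Defs.v *)
From mathcomp Require Import all_boot.
From mathcomp Require Import classical_sets functions cardinality.

Set Implicit Arguments.
Unset Strict Implicit.
Unset Printing Implicit Defensive.

Record graph (V : finType) := Graph {
  edges :> {set {set V}};
  edges_card2 : forall e : {set V}, e \in edges -> #|e| = 2 }.

Fact complete_graph_subproof (n : nat) (e : {set 'I_n}) :
  e \in [set e' : {set 'I_n} | #|e'| == 2] -> #|e| = 2.
Proof. by rewrite inE => /eqP. Qed.

Definition complete_graph (n : nat) : graph 'I_n :=
  Graph (@complete_graph_subproof n).

(* The codomain of a multi-labeling is the power set of {1, 2, ...}, whence
   the positivity condition. *)
Definition multi_labeling (V : finType) (c : V -> set nat) : Prop :=
  forall (v : V) (k : nat), c v k -> 0 < k.

Definition labeling (t : nat) (V : finType) (c : V -> set nat) : Prop :=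
  multi_labeling c /\ forall v : V, (c v #<= `I_t)%card.

(* A coloring is a total function on {set V}; only its values on the edges of
   G are constrained. *)
Definition edge_coloring (V : finType) (G : graph V) (m : nat)
    (c' : {set V} -> nat) : Prop :=
  (forall e : {set V}, e \in edges G -> 1 <= c' e <= m) /\
  (forall e f : {set V}, e \in edges G -> f \in edges G ->
     e != f -> ~~ [disjoint e & f] -> c' e != c' f).

Definition avoids (V : finType) (G : graph V) (c : V -> set nat)
    (c' : {set V} -> nat) : Prop :=
  forall e : {set V}, e \in edges G ->
  ~ (\bigcup_(v in [set` e]) c v)%classic (c' e).

Definition avoiding_colorable (V : finType) (G : graph V) (c : V -> set nat)
    (m : nat) : Prop :=
  0 < m /\ exists c' : {set V} -> nat, edge_coloring G m c' /\ avoids G c c'.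

(* "The c-avoiding chromatic index of G exists and equals m": it is a relation
   because no such coloring need exist when the sets c v are infinite. *)
Definition is_avoiding_chromatic_index (V : finType) (G : graph V)
    (c : V -> set nat) (m : nat) : Prop :=
  avoiding_colorable G c m /\
  forall k : nat, avoiding_colorable G c k -> m <= k.

(* "The t-avoiding chromatic index of G exists and equals m": the index of
   every t-labeling exists, and m is the largest of them. *)
Definition is_t_avoiding_chromatic_index (t : nat) (V : finType) (G : graph V)
    (m : nat) : Prop :=
  (exists c : V -> set nat,
     labeling t c /\ is_avoiding_chromatic_index G c m) /\
  (forall c : V -> set nat, labeling t c ->
     exists k : nat, is_avoiding_chromatic_index G c k /\ k <= m).

(* Main.v *)
Require Import Defs.
From mathcomp Require Import boolp classical_sets functions cardinality.
From mathcomp Require Import all_boot zify.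

(* Lower bound: label one vertex v0 by 1 and all others by 2. Then colors 1 and
   2 are both forbidden at v0, whose n - 1 edges need distinct colors.
   Upper bound, by detaching vertices one at a time from an amalgamation: with
   n + 1 colors every vertex misses exactly two, of which one is its label and
   the other is free. Start from a single blob carrying all edges as colored
   loops. When k vertices are still in the blob, the bipartite multigraph of
   colors against the pieces of the blob (its edges to each detached vertex, its
   half-loops dealt to k - 1 pieces, its labels, its free misses) is
   k-regular, so it has a perfect matching, which tells how the next vertex
   sees each color. The vertex detached is one whose label is the label chosen
   by the matching. *)

Set Implicit Arguments.
Unset Strict Implicit.
Unset Printing Implicit Defensive.

(** * Hall's theorem and matchings in regular bipartite multigraphs *)

(* Rado's argument: if deleting x and deleting y from A i both violate Hall's
   condition, the union and the intersection of the two violating index sets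
   contradict it for A. *)
Lemma hall (I T : finType) (A : I -> {set T}) :
  (forall J : {set I}, #|J| <= #|\bigcup_(i in J) A i|) ->
  exists s : I -> T, injective s /\ forall i, s i \in A i.
Proof.
have [N] := ubnP (\sum_i #|A i|); elim: N A => // N IH A ltN hallA.
have [/existsP[i /card_gt1P[x [y [xA yA xy]]]]|/existsPn small] :=
  boolP [exists i, 1 < #|A i|]; last first.
  have /fin_all_exists[s sA] i : exists x, A i = [set x].
    apply/cards1P; rewrite eqn_leq leqNgt (small i) /=.
    by have := hallA [set i]; rewrite cards1 big_set1.
  exists s; split=> [i j sij|i]; last by rewrite sA set11.
  apply/eqP; apply: contraT => ij; have := hallA [set i; j].
  by rewrite cards2 ij bigcup_setU !big_set1 !sA sij setUid cards1.
pose A' z := [eta A with i |-> A i :\ z].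
have shrink z : z \in A i ->
    (exists s : I -> T, injective s /\ forall i, s i \in A i) \/
    exists2 J : {set I}, i \in J & #|\bigcup_(j in J) A' z j| < #|J|.
  move=> zA; have [/existsP[J bad]|/existsPn good] :=
    boolP [exists J : {set I}, #|\bigcup_(j in J) A' z j| < #|J|].
    right; exists J => //; apply: contraLR bad => iJ; rewrite -leqNgt.
    rewrite (eq_bigr A) // => j jJ /=; case: eqP => // ji.
    by rewrite -ji jJ in iJ.
  left; have [||s [s_inj sA']] := IH (A' z).
  - rewrite -ltnS; apply: leq_trans ltN; rewrite ltnS.
    rewrite (bigD1 i) // [ltnRHS](bigD1 i) //= eqxx -addSn leq_add //.
      by rewrite [ltnRHS](cardsD1 z) zA.
    by apply: leq_sum => j /negPf->.
  - by move=> J; rewrite leqNgt good.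
  - exists s; split=> // j; have := sA' j; rewrite /A' /=.
    by case: eqP => // ->; case/setD1P.
have [//|[J iJ badJ]] := shrink x xA.
have [//|[K iK badK]] := shrink y yA.
(* Writing [X] and [Y] for the two shrunken unions, Hall's condition gives
   [#|J| + #|K| - 1 <= #|X| + #|Y|], while the violations bound the right side by
   [#|J| + #|K| - 2]. *)
have := hallA (J :|: K); have := hallA ((J :&: K) :\ i).
have := cardsUI J K; have := cardsD1 i (J :&: K); rewrite inE iJ iK /=.
have := cardsUI (\bigcup_(j in J) A' x j) (\bigcup_(j in K) A' y j).
have : #|\bigcup_(j in J :|: K) A j|
    <= #|\bigcup_(j in J) A' x j :|: \bigcup_(j in K) A' y j|.
  apply/subset_leq_card/bigcupsP => j jJK; apply/subsetP => z zA.
  have [ji|ji] := eqVneq j i.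
    have [zx|zx] := eqVneq z x; apply/setUP; [right|left]; apply/bigcupP;
      exists i => //=; rewrite eqxx !inE -ji zA andbT //.
    by rewrite zx.
  by case/setUP: jJK => jJ; apply/setUP; [left|right]; apply/bigcupP;
    exists j => //=; rewrite (negPf ji).
have : #|\bigcup_(j in (J :&: K) :\ i) A j|
    <= #|\bigcup_(j in J) A' x j :&: \bigcup_(j in K) A' y j|.
  apply/subset_leq_card/bigcupsP => j /setD1P[ji /setIP[jJ jK]].
  apply/subsetP => z zA; apply/setIP.
  by split; apply/bigcupP; exists j => //=; rewrite (negPf ji).
lia.
Qed.

(** The total weight [k * #|J|] of the rows in [J] lands in the columns adjacent to [J], each of
    which holds only [k]; this is Hall's condition. Counting the whole weight by columns and by rows
    makes the injection bijective. *)
Lemma regular_matching (I T : finType) (M : I -> T -> nat) (k : nat) :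
  0 < k -> (forall i, \sum_x M i x = k) -> (forall x, \sum_i M i x = k) ->
  exists s : I -> T, bijective s /\ forall i, 0 < M i (s i).
Proof.
move=> k_gt0 row col.
have [J|s [s_inj sM]] := @hall I T (fun i => [set x | 0 < M i x]).
  set N := \bigcup_(i in J) _; rewrite -(leq_pmul2r k_gt0) -!sum_nat_const.
  rewrite (eq_bigr (fun i => \sum_(x in N) M i x)) => [|i iJ].
    rewrite exchange_big leq_sum // => x _.
    by rewrite -(col x) [leqRHS](bigID (mem J)) leq_addr.
  rewrite -(row i) (bigID (mem N)) /= [X in _ + X]big1 ?addn0 // => x xN.
  apply/eqP; rewrite -leqn0 leqNgt; apply: contra xN => Mix.
  by apply/bigcupP; exists i; rewrite ?inE.
exists s; split=> [|i]; last by have := sM i; rewrite inE.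
apply: (inj_card_bij s_inj); rewrite -(leq_pmul2r k_gt0) -!sum_nat_const.
rewrite (eq_bigr (fun x => \sum_i M i x)) 1?exchange_big /= ?leq_sum // => i _.
by rewrite row.
Qed.

(** * Detaching vertices from an amalgamation *)

Lemma sum_option (T : finType) (F : option T -> nat) :
  \sum_x F x = F None + \sum_x F (Some x).
Proof.
rewrite (bigD1 None) //=; congr (_ + _); rewrite (reindex_omap Some id) //=; last by case.
by apply: eq_bigl => x; rewrite eqxx.
Qed.

Lemma sum_eq_Some (T : finType) (A : {set T}) (x : option T) :
  \sum_(v in A) (x == Some v) = nat_of_bool (if x is Some v then v \in A else false).
Proof.
case: x => [u|]; last by rewrite big1.
have [uA|uA] := boolP (u \in A); last first.
  by rewrite big1 // => v vA; case: eqP => // -[uv]; rewrite uv vA in uA.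
rewrite (bigD1 u) //= eqxx big1 // => v /andP[_ /negPf vu].
by rewrite (inj_eq Some_inj) eq_sym vu.
Qed.

Section Detach.
Context {V I : finType}.
Implicit Types (c : V -> I) (B : {set V}) (e : V -> I -> bool) (l f : I -> nat).

(* B is the set of vertices still in the blob: e u i tells whether the detached
   vertex u has an edge of color i to the blob, l i counts the loops of color i,
   and f i the free misses of color i still to be distributed in the blob. *)
Record outline c B e l f : Prop := Outline {
  outline_color : forall i, \sum_(v in ~: B) e v i + (l i).*2
    + \sum_(v in B) (c v == i) + f i = #|B|;
  outline_edges : forall v, v \notin B -> \sum_i e v i = #|B|;
  outline_loops : \sum_i l i = 'C(#|B|, 2);
  outline_free : \sum_i f i = #|B| }.

(** [g u v] is the color of the edge [uv]. Two vertices outside [B] are constrained by symmetry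
    only: the color of their edge is settled at the earlier stage that detached the second of
    them. *)
Record detachment c B e (g : V -> V -> I) : Prop := Detachment {
  detachment_sym : forall u v, g u v = g v u;
  detachment_edge : forall u v, u \notin B -> v \in B -> e u (g u v);
  detachment_out_inj : forall u, u \notin B -> {in B &, injective (g u)};
  detachment_inj : forall u, u \in B -> {in predC1 u &, injective (g u)};
  detachment_label : forall u v, u \in B -> v != u -> g u v != c u }.

(* Slots of the matching: None is the free miss, Some b0 the label, Some v an edge
   to v for v outside B, and a half-loop for v in B :\ b0. *)
Lemma outline_matching c B e l f b0 : #|I| = #|V|.+1 -> b0 \in B ->
    outline c B e l f ->
  exists s : I -> option V, bijective s /\ forall i,
    match s i with
    | Some v => if v \in B then if v == b0 then exists2 b, b \in B & c b = i
                                else 0 < l i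
                else e v i
    | None => 0 < f i
    end.
Proof.
move=> cardI b0B [row col loops free].
have B_gt0 : 0 < #|B| by apply/card_gt0P; exists b0.
(* All k - 1 half-loop slots share the same neighbors, so instead of dealing the
   half-loops out, every other multiplicity is scaled by k - 1, or by 1 in
   the loopless case k = 1. *)
pose w := maxn 1 #|B|.-1.
have w_gt0 : 0 < w by rewrite leq_max.
pose M i x := match x with
  | Some v => if v \in B then if v == b0 then w * \sum_(v in B) (c v == i)
                              else (l i).*2
              else w * e v i
  | None => w * f i end.
have cardB' : #|B :\ b0| = #|B|.-1 by rewrite (cardsD1 b0 B) b0B.
have [|||s [s_bij sM]] := @regular_matching _ _ M (w * #|B|).
- by rewrite muln_gt0 w_gt0.
- move=> i; rewrite sum_option /= -(row i) (bigID (mem B)) /= (bigD1 b0) //= b0B eqxx.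
  rewrite [X in _ + (_ + X + _)](eq_bigr (fun=> (l i).*2));
    last by move=> v /andP[-> /negPf->].
  rewrite sum_nat_cond_const.
  rewrite (_ : #|_| = #|B|.-1); last first.
    by rewrite -cardB'; apply: eq_card => v; rewrite !inE andbC.
  rewrite [X in _ + (_ + _ + X)](eq_bigr (fun v => w * e v i));
    last by move=> v /negPf->.
  rewrite -big_distrr /= [X in _ = w * (X + _ + _ + _)](eq_bigl (fun v => v \notin B));
    last by move=> v; rewrite inE.
  suff -> : #|B|.-1 * (l i).*2 = w * (l i).*2 by lia.
  have [B_le1|B_gt1] := leqP #|B| 1; last by congr (_ * _); rewrite /w; lia.
  suff -> : l i = 0 by rewrite !muln0.
  by apply/eqP; rewrite -leqn0; move: loops; rewrite bin_small // (bigD1 i) //=; lia.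
- case=> [v|] /=; last by rewrite -big_distrr /= free.
  rewrite /M; have [vB|vB] := boolP (v \in B); last by rewrite -big_distrr /= col.
  have [vb0|vb0] := eqVneq v b0.
    rewrite -big_distrr /= exchange_big /= -[in RHS]sum1_card.
    congr (_ * _); apply: eq_bigr => u _.
    by rewrite (bigD1 (c u)) //= eqxx big1 // => i /negPf; rewrite eq_sym => ->.
  (* A second vertex in the blob gives [w = #|B|.-1], so the column sum [2 * 'C(#|B|, 2)] equals
     [w * #|B|]. *)
  have B_gt1 : 1 < #|B| by rewrite (cardsD1 b0 B) b0B (cardsD1 v) !inE vb0 vB.
  rewrite (eq_bigr (fun i => 2 * l i)); last by move=> i _; rewrite mul2n.
  rewrite -big_distrr /= loops -(mul_bin_diag #|B| 1) bin1 mulnC.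
  by congr (_ * _); rewrite /w; lia.
exists s; split=> // i; have := sM i; rewrite /M; case: (s i) => [v|].
  case: ifP => vB; last by rewrite muln_gt0; case: (e v i); rewrite // andbF.
  case: eqP => _; last by rewrite double_gt0.
  rewrite muln_gt0 => /andP[_ pos].
  have [/existsP[b /andP[bB /eqP cb]]|/existsPn none] :=
    boolP [exists b, (b \in B) && (c b == i)]; first by exists b.
  by rewrite big1 // in pos => b bB; have := none b; rewrite bB /= => /negPf->.
by rewrite muln_gt0 => /andP[].
Qed.

Lemma detach c B e l f : #|I| = #|V|.+1 -> outline c B e l f ->
  exists g, detachment c B e g.
Proof.
move=> cardI; have /card_gt0P[i0 _] : 0 < #|I| by rewrite cardI.
have [N] := ubnP #|B|.
elim: N B e l f => // N IH B e l f ltN outl.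
have [->|[b0 b0B]] := set_0Vmem B.
  by exists (fun _ _ => i0); split=> // u; do ?[by rewrite inE]; move=> v w; rewrite !inE.
have [s [[t sK tK] sP]] := outline_matching cardI b0B outl.
case: outl => row col loops free.
(* [b0] only names the label slot; the vertex to detach is [b], which carries the color matched to
   that slot and may differ from [b0]. *)
have [b bB cb] : exists2 b, b \in B & c b = t (Some b0).
  by have := sP (t (Some b0)); rewrite tK b0B eqxx.
have sb i : (c b == i) = (s i == Some b0).
  by rewrite cb; apply/eqP/eqP => [<-|<-]; rewrite ?tK ?sK.
pose loop i := if s i is Some v then v \in B :\ b0 else false.
pose out i := if s i is Some v then v \notin B else false.
(* A loop whose color is in a half-loop slot becomes an edge from [b] to the remaining blob. The
   edge of [u] with color [t (Some u)] now ends at [b], so it no longer reaches the blob. *)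
pose e' u i := if u == b then loop i else e u i && (s i != Some u).
have l_loop i : loop i <= l i.
  rewrite /loop; have := sP i; case: (s i) => // v; rewrite !inE.
  by case: ifP; case: eqP.
have f_none i : (s i == None) <= f i by have := sP i; case: (s i).
have cardB : #|B| = #|B :\ b|.+1 by rewrite (cardsD1 b B) bB.
have sum_s x : \sum_i (s i == x) = 1.
  rewrite (bigD1 (t x)) //= tK eqxx big1 // => i /eqP it.
  by case: eqP => // six; case: it; rewrite -six sK.
have sum_loop : \sum_i loop i = #|B :\ b|.
  under eq_bigr do rewrite /loop -sum_eq_Some.
  rewrite exchange_big /= (eq_bigr (fun=> 1)) // sum1_card.
  by have := cardsD1 b0 B; rewrite b0B; lia.
have outB v : v \notin B -> v != b by move=> vB; apply: contraNneq vB => ->.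
have e_e' v i : v \notin B -> e v i = e' v i + (s i == Some v) :> nat.
  move=> vB; rewrite /e' (negPf (outB v vB)); case: eqP => [siv|_].
    by have := sP i; rewrite siv (negPf vB) => ->.
  by rewrite andbT addn0.
have [||g [gC gE gout gin glab]] :=
  IH (B :\ b) e' (fun i => l i - loop i) (fun i => f i - (s i == None)).
- by rewrite -ltnS -cardB; lia.
- split.
  + move=> i; have := row i; rewrite cardB.
    have -> : \sum_(v in ~: (B :\ b)) e' v i = loop i + \sum_(v in ~: B) e' v i.
      rewrite setCD setUC big_setU1 /= ?inE ?bB //.
      by rewrite {1}/e' eqxx.
    rewrite (big_setD1 b bB) /= sb.
    have -> : \sum_(v in ~: B) e v i = out i + \sum_(v in ~: B) e' v i.
      rewrite /out (_ : (match s i with Some v => v \notin B | None => false end) =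
        (if s i is Some v then v \in ~: B else false));
        last by case: (s i) => // v; rewrite inE.
      rewrite -sum_eq_Some -big_split /=; apply: eq_bigr => v; rewrite inE => vB.
      by rewrite e_e' // addnC.
    (* Color [i] fills exactly one slot of [b], so its count drops by one, as [#|B|] does. In the
       loop case two half-loops go and one edge from [b] comes. *)
    have : out i + (s i == Some b0) + (s i == None) + loop i = 1.
      rewrite /out /loop; case: (s i) => // v.
      rewrite (inj_eq Some_inj) !inE; case: (eqVneq v b0) => [->|_] /=.
        by rewrite b0B.
      by case: (v \in B).
    have := l_loop i; have := f_none i.
    by move: (out i) (loop i) (s i == None) (s i == Some b0); lia.
  + move=> v; rewrite !inE negb_and negbK => /orP[/eqP->|vB].
      by rewrite -sum_loop; apply: eq_bigr => i _; rewrite /e' eqxx.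
    have := col v vB; rewrite (eq_bigr _ (fun i _ => e_e' v i vB)) big_split /= sum_s cardB.
    by lia.
  + have : \sum_i l i = \sum_i (l i - loop i) + \sum_i loop i.
      by rewrite -big_split; apply: eq_bigr => i _ /=; rewrite subnK.
    by rewrite loops sum_loop cardB binS bin1; lia.
  + have : \sum_i f i = \sum_i (f i - (s i == None)) + \sum_i (s i == None).
      by rewrite -big_split; apply: eq_bigr => i _ /=; rewrite subnK.
    by rewrite free sum_s cardB; lia.
pose g' u v := if (u == b) && (v \notin B) then t (Some v) else
               if (v == b) && (u \notin B) then t (Some u) else g u v.
have g'_in u v : u \in B -> u != b -> g' u v = g u v.
  by move=> uB ub; rewrite /g' (negPf ub) uB andbF.
have g'_b_in v : v \in B -> g' b v = g b v.
  by move=> vB; rewrite /g' vB bB !andbF.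
have g'_b_out v : v \notin B -> g' b v = t (Some v).
  by move=> vB; rewrite /g' vB eqxx.
have g'C u v : g' u v = g' v u.
  rewrite /g' gC; do 2 case: (boolP (_ && _)) => //.
  by move=> /andP[/eqP->]; rewrite bB andbF.
have g'_out u v : u \notin B -> v \in B -> v != b -> g' u v = g u v.
  by move=> uB vB vb; rewrite g'C g'_in // gC.
have g_loop v : v \in B :\ b -> loop (g b v).
  by move=> vB; have := gE b v; rewrite !inE eqxx /= -in_setD1 vB /e' eqxx; apply.
have g_e' u v : u \notin B -> v \in B :\ b -> e' u (g u v).
  by move=> uB vB; apply: gE => //; rewrite !inE negb_and uB orbT.
exists g'; split=> //.
- move=> u v uB vB; have [->|vb] := eqVneq v b.
    by rewrite g'C g'_b_out //; have := sP (t (Some u)); rewrite tK (negPf uB).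
  have := g_e' u v uB; rewrite !inE vb vB g'_out // /e' (negPf (outB u uB)).
  by case/(_ isT)/andP.
- move=> u uB.
  (* The color given to the edge [ub] was removed from [e' u]. *)
  have t_ne v : v \in B :\ b -> t (Some u) != g u v.
    move=> vB; have := g_e' u v uB vB; rewrite /e' (negPf (outB u uB)).
    by case/andP=> _; apply: contraNneq => <-; rewrite tK.
  have gb : g' u b = t (Some u) by rewrite g'C g'_b_out.
  move=> v w vB wB; have [->|vb] := eqVneq v b; have [->|wb] := eqVneq w b => //.
  + by rewrite gb g'_out // => /eqP; rewrite (negPf (t_ne w _)) // !inE wb.
  + by rewrite gb g'_out // => /esym/eqP; rewrite (negPf (t_ne v _)) // !inE vb.
  + rewrite !g'_out //; apply: gout; rewrite !inE ?vb ?wb //.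
    by rewrite (negPf uB) andbF.
- move=> u uB; have [->|ub] := eqVneq u b; last first.
    move=> v w vu wu; rewrite !g'_in //; apply: (gin u) => //.
    by rewrite !inE ub.
  (* Toward the blob [b] uses colors of half-loop slots, toward detached vertices those of edge
     slots. *)
  have t_ne v w : v \in B :\ b -> w \notin B -> g b v != t (Some w).
    move=> vB wB; apply/eqP => gbv; have := g_loop v vB.
    by rewrite /loop gbv tK !inE (negPf wB) andbF.
  move=> v w; rewrite !inE => vb wb.
  have [vB|vB] := boolP (v \in B); have [wB|wB] := boolP (w \in B).
  + rewrite !g'_b_in //; apply: gout; rewrite !inE ?eqxx ?vb ?wb //.
  + by rewrite g'_b_in // g'_b_out // => /eqP; rewrite (negPf (t_ne v w _ _)) // !inE vb.
  + by rewrite g'_b_out // g'_b_in // => /esym/eqP; rewrite (negPf (t_ne w v _ _)) // !inE wb.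
  + by rewrite !g'_b_out // => /(can_inj tK)[].
- move=> u v uB vu; have [ub|ub] := eqVneq u b; last first.
    by rewrite g'_in // glab // !inE ub.
  rewrite ub eq_sym sb; have [vB|vB] := boolP (v \in B); last first.
    by rewrite g'_b_out // tK (inj_eq Some_inj); apply: contraNneq vB => ->.
  rewrite g'_b_in //; have := g_loop v; rewrite !inE -ub vu vB /loop => /(_ isT).
  by case: (s _) => // w; rewrite !inE => /andP[].
Qed.
End Detach.

(** * The initial blob *)

Lemma sum_shrink (I : finType) (F : I -> nat) (m : nat) : m <= \sum_i F i ->
  exists2 l : I -> nat, (forall i, l i <= F i) & \sum_i l i = m.
Proof.
elim: m => [_|m IH ltm]; first by exists (fun=> 0); rewrite ?big1.
have [l lF suml] := IH (ltnW ltm).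
have [/existsP[i lt_i]|/existsPn ge] := boolP [exists i, l i < F i]; last first.
  move: ltm; rewrite ltnNge -suml leq_sum // => i _.
  by rewrite leqNgt ge.
exists (fun j => l j + (j == i)) => [j|].
  by have := lF j; case: eqP => [->|_]; lia.
by rewrite big_split /= suml (bigD1 i) //= eqxx big1 ?addn1 // => j /negPf->.
Qed.

(** Color [i] has [n - d i] places off the labels, [n * n] over all colors. Pairing them into loops
    wastes at most one per color, so at least [(n * n - n - 1) / 2] loops fit; as [n * n - n] is
    even, ['C(n, 2)] do. The [n] places left over are the free misses. *)
Lemma outline_init (V I : finType) (c : V -> I) : #|I| = #|V|.+1 ->
  exists l f, outline c [set: V] (fun _ _ => false) l f.
Proof.
move=> cardI; set n := #|V|.
pose d i := \sum_(v in [set: V]) (c v == i).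
have d_le i : d i <= n.
  by rewrite /n -cardsT -sum1_card leq_sum // => v _; case: eqP.
have sum_d : \sum_i d i = n.
  rewrite exchange_big /= -[RHS]cardsT -sum1_card; apply: eq_bigr => v _.
  by rewrite (bigD1 (c v)) //= eqxx big1 // => i /negPf; rewrite eq_sym => ->.
have sum_nd : \sum_i (n - d i) = n * n.
  have : \sum_i (n - d i) + \sum_i d i = n.+1 * n.
    rewrite -big_split /= (eq_bigr (fun=> n)) => [|i _]; last by rewrite subnK.
    by rewrite sum_nat_const cardI.
  by rewrite sum_d; lia.
have bin_n : 'C(n, 2).*2 + n = n * n.
  by have := mul_bin_diag n 1; rewrite bin1; case: (n) => [|m] /=; lia.
have [|l l_le sum_l] := @sum_shrink I (fun i => (n - d i)./2) 'C(n, 2).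
  have : \sum_i odd (n - d i) <= n.+1.
    by rewrite -cardI -sum1_card leq_sum // => i _; case: odd.
  have : \sum_i odd (n - d i) + (\sum_i (n - d i)./2).*2 = n * n.
    rewrite -sum_nd -mul2n big_distrr -big_split /=; apply: eq_bigr => i _.
    by rewrite mul2n odd_double_half.
  by lia.
exists l, (fun i => n - d i - (l i).*2); split.
- move=> i; rewrite cardsT big1 // -/(d i); have := l_le i; have := d_le i.
  by rewrite -/n; lia.
- by move=> v; rewrite inE.
- by rewrite cardsT.
- have : \sum_i (n - d i - (l i).*2) + (\sum_i l i).*2 = n * n.
    rewrite -sum_nd -mul2n big_distrr -big_split /=; apply: eq_bigr => i _.
    by have := l_le i; lia.
  by rewrite cardsT sum_l -/n; lia.
Qed.

Lemma complete_coloring (V I : finType) (c : V -> I) : #|I| = #|V|.+1 ->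
  exists g : V -> V -> I, [/\ forall u v, g u v = g v u,
    forall u, {in predC1 u &, injective (g u)} &
    forall u v, v != u -> g u v != c u].
Proof.
move=> cardI; have [l [f outl]] := outline_init c cardI.
have [g [gC _ _ g_inj g_lab]] := detach cardI outl.
by exists g; split=> // [u|u v]; [apply: g_inj|apply: g_lab]; rewrite inE.
Qed.

(** * Upper bound: from colored pairs to avoiding edge colorings *)

Lemma card_le_I1_eq (T : Type) (A : set T) : (A #<= `I_1)%card ->
  forall x y, A x -> A y -> x = y.
Proof.
move=> /pcard_leP[f] x y Ax Ay; pose g : T -> nat := f.
have g0 z : A z -> g z = 0.
  by move=> /(@funS _ _ _ _ f) /=; rewrite -/(g z); case: (g z).
have g_inj : {in A &, injective g} by exact: inj_hint.
by apply: g_inj; [exact: mem_set|exact: mem_set|rewrite !g0].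
Qed.

Lemma card2_pair (T : finType) (e : {set T}) x : #|e| = 2 -> x \in e ->
  exists2 y, y != x & e = [set x; y].
Proof.
move=> /eqP/cards2P[u [v [uv ->]]]; rewrite !inE => /orP[]/eqP->.
  by exists v; rewrite // eq_sym.
by exists u; rewrite // setUC.
Qed.

Lemma symmetric_edge_map (T : finType) (g : T -> T -> nat) :
  (forall x y, g x y = g y x) ->
  exists h : {set T} -> nat, forall x y, h [set x; y] = g x y.
Proof.
move=> gC.
exists (fun e => if [pick p | e == [set p.1; p.2]] is Some p then g p.1 p.2 else 0).
move=> x y; case: pickP => [[u v] /= /eqP E|/(_ (x, y))/=]; last by rewrite eqxx.
have /set2P xP : x \in [set u; v] by rewrite -E set21.
have /set2P yP : y \in [set u; v] by rewrite -E set22.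
have /set2P uP : u \in [set x; y] by rewrite E set21.
have /set2P vP : v \in [set x; y] by rewrite E set22.
by case: xP => ?; case: yP => ?; subst=> //; case: uP => ?; case: vP => ?; subst.
Qed.

Lemma complete_avoiding_colorable (n : nat) (c : 'I_n -> set nat) :
  labeling 1 c -> avoiding_colorable (complete_graph n) c n.+1.
Proof.
move=> [c_gt0 c_le1].
(* Color [i] of ['I_n.+1] stands for [i.+1]. A vertex with no label up to [n.+1] gets the dummy
   label [ord0], which only adds a restriction. *)
have /fin_all_exists[c0 c0P] v : exists i : 'I_n.+1,
    forall k, c v k -> k <= n.+1 -> k = i.+1.
  have [[k [cvk k_le]]|none] := pselect (exists k, c v k /\ k <= n.+1).
    have k_gt0 := c_gt0 v k cvk.
    have k_lt : k.-1 < n.+1 by rewrite prednK.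
    exists (Ordinal k_lt) => j cvj _ /=; rewrite prednK //.
    exact: card_le_I1_eq (c_le1 v) _ _ cvj cvk.
  by exists ord0 => k cvk k_le; case: none; exists k.
have [|g [gC g_inj g_lab]] := complete_coloring c0; first by rewrite !card_ord.
have [|h hE] := @symmetric_edge_map _ (fun u v => (g u v).+1).
  by move=> u v; rewrite gC.
split=> //; exists h; split; first split.
- move=> e /edges_card2/eqP/cards2P[u [v [_ ->]]].
  by rewrite hE /= ltn_ord.
- move=> e f /edges_card2 e2 /edges_card2 f2 ef /pred0Pn[u /andP[/= ue uf]].
  have [v vu eE] := card2_pair e2 ue; have [w wu fE] := card2_pair f2 uf.
  rewrite eE fE !hE eqSS; apply: contra ef => /eqP/val_inj/(g_inj u) vw.
  by rewrite eE fE vw.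
- move=> e /edges_card2 e2 [u /= ue].
  have [v vu ->] := card2_pair e2 ue; rewrite hE => cuk.
  have /eqP := c0P u _ cuk (ltn_ord _); rewrite eqSS => /eqP/val_inj/eqP.
  by rewrite (negPf (g_lab _ _ vu)).
Qed.

Lemma avoiding_chromatic_index_le (V : finType) (G : graph V) (c : V -> set nat) m :
  avoiding_colorable G c m ->
  exists2 k, is_avoiding_chromatic_index G c k & k <= m.
Proof.
move=> col_m.
have ex : exists k, `[< avoiding_colorable G c k >] by exists m; apply/asboolP.
case: (ex_minnP ex) => k /asboolP col_k k_min.
exists k; last exact/k_min/asboolP.
by split=> // j col_j; exact/k_min/asboolP.
Qed.

(** * Lower bound *)

Lemma pointed_labeling_bound n (v0 : 'I_n) k : 2 <= n ->
  avoiding_colorable (complete_graph n)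
    (fun v => if v == v0 then [set 1] else [set 2])%classic k ->
  n.+1 <= k.
Proof.
move=> n_ge2 [_ [h [[h_rng h_inj] h_av]]].
have edge v : v != v0 -> [set v0; v] \in edges (complete_graph n).
  by move=> vv0; rewrite inE cards2 (eq_sym v0) vv0.
pose s := [seq h [set v0; v] | v <- enum (predC1 v0)].
have size_s : size s = n.-1 by rewrite size_map -cardE cardC1 card_ord.
have s_uniq : uniq s.
  rewrite map_inj_in_uniq ?enum_uniq // => u v; rewrite !mem_enum => uv0 vv0 /eqP.
  apply: contraTeq => uv; apply: h_inj; rewrite ?edge //.
    apply: contra uv => /eqP/setP/(_ u); rewrite !inE eqxx orbT.
    by rewrite (negPf uv0) => /esym.
  by apply/pred0Pn; exists v0; rewrite /= !inE eqxx.
(* The list is [3, ..., k]. Its length [k - 2] is at least [n.-1 > 0], so the subtraction is not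
   truncated and [n.+1 <= k] follows. *)
have s_sub : {subset s <= iota 3 (k - 2)}.
  move=> _ /mapP[v /[!mem_enum] vv0 ->].
  have := h_rng _ (edge v vv0); have := h_av _ (edge v vv0).
  rewrite mem_iota; move: (h _) => j j_av.
  have j1 : j <> 1 by move=> j1; apply: j_av; exists v0; rewrite /= ?inE eqxx.
  have j2 : j <> 2.
    by move=> j2; apply: j_av; exists v; rewrite /= ?inE ?eqxx ?orbT ?(negPf vv0).
  lia.
have := uniq_leq_size s_uniq s_sub; rewrite size_s size_iota; lia.
Qed.

Theorem theorem2p7 (n : nat) (hn : 2 <= n) :
  is_t_avoiding_chromatic_index 1 (complete_graph n) n.+1.
Proof.
split=> [|c c_lab]; last first.
  have [k] := avoiding_chromatic_index_le (complete_avoiding_colorable c_lab).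
  by exists k.
pose v0 : 'I_n := Ordinal (ltnW hn).
pose c v := (if v == v0 then [set 1] else [set 2])%classic.
have c_lab : labeling 1 c.
  by split=> [v k|v]; rewrite /c; case: ifP => _;
    [move=> /= -> | move=> /= -> | rewrite (card_le_eql card_set1) ..].
exists c; split=> //; split; first exact: complete_avoiding_colorable.
by move=> k; apply: pointed_labeling_bound.
Qed.
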